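(* Let $\mathbb{H}$ be a Hilbert space, let $C \subseteq \mathbb{H}$ be a convex set, let $\mathbb{S} = \{x \in \mathbb{H} : \|x\| = 1\}$ be the unit sphere, and assume that $\mathbb{S} \cap C \neq \emptyset$. Let $T = T_{\mathbb{S},C} = \frac{I + R_C R_{\mathbb{S}}}{2}$ be the Douglas-Rachford operator, and let $x_0 \in \mathbb{S} \cap C$. Assume also that $\alpha, \beta, r \ge 0$ are such that $\beta \in [0,1)$, $r \ge \frac{2}{1-\beta}$, and $\alpha \le \frac{1}{1-\beta}$. Then there exists $G : \mathbb{H} \to \mathbb{H}$ such that $$\sup_{x \in B[x_0,r] \setminus B(0,1-\beta)} \|Gx - Tx\| \le 2r\left(1 - \alpha(1-\beta)\right),$$ and for all $n \in \mathbb{N}$, $$\sup_{x,y \in B[x_0,r]} \|G^n x - G^n y\| \le 2r\alpha^n.$$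
   Context: $\|\cdot\|$ is the Hilbert norm on $\mathbb{H}$. $B(x,r)$ and $B[x,r]$ denote respectively the open and closed ball with centre $x$ and radius $r$. $I$ is the identity operator on $\mathbb{H}$. For a set $A \subseteq \mathbb{H}$, the (in general multi-valued) projection operator is $P_A x = \{y \in A : \|x-y\| = \inf_{z \in A}\|x-z\|\}$, and the reflection operator is $R_A = 2P_A - I$. For the unit sphere and $x \ne 0$, $P_{\mathbb{S}} x = x/\|x\|$ and $R_{\mathbb{S}} x = \left(\frac{2}{\|x\|} - 1\right)x$. $R_C R_{\mathbb{S}}$ denotes composition ($R_{\mathbb{S}}$ is applied first), and $G^n$ denotes the $n$-fold composition of $G$ with itself. *)

(* Defs.v *)
From HB Require Import structures.
From mathcomp Require Import all_boot all_order all_algebra.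
From mathcomp Require Import all_classical all_reals all_analysis.

Set Implicit Arguments.
Unset Strict Implicit.
Unset Printing Implicit Defensive.

Import Order.TTheory GRing.Theory Num.Theory.
Import numFieldNormedType.Exports.

Local Open Scope classical_set_scope.
Local Open Scope ring_scope.

Section DouglasRachford.
Context {R : realType} {V : normedModType R}.
Implicit Types (A B : set V) (x : V).

(* Set-valued maps are functions V -> set V. A projection may be empty (no
   nearest point) or contain several points, such as that of 0 on the sphere. *)

Definition unit_sphere : set V := [set x | `|x| = 1].

Definition metric_proj A x : set V :=
  [set y | A y /\ `|x - y| = inf [set `|x - z| | z in A]].

Definition reflector A x : set V := [set 2 *: p - x | p in metric_proj A x].

(* T_{A,B} = (I + R_B R_A) / 2, with the composition of set-valued maps
   (R_B R_A) x = \bigcup_(y in R_A x) R_B y. *)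
Definition douglas_rachford A B x : set V :=
  [set 2^-1 *: (x + w) | w in \bigcup_(y in reflector A x) reflector B y].

End DouglasRachford.

Arguments unit_sphere {R} V.

(* Main.v *)
Require Import Defs.
From HB Require Import structures.
From mathcomp Require Import all_boot all_order all_algebra.
From mathcomp Require Import all_classical all_reals all_analysis.
From mathcomp Require Import ring lra.

Set Implicit Arguments.
Unset Strict Implicit.
Unset Printing Implicit Defensive.

Import Order.TTheory GRing.Theory Num.Theory.
Import numFieldNormedType.Exports.

Local Open Scope classical_set_scope.
Local Open Scope ring_scope.

(** Put rho = 1 - beta. Off the open ball of radius rho, the projection onto
    the sphere is x |-> x / |x|, which agrees there with
    normalize x = x / max(rho, |x|); and rho * normalize is the projection onto
    the closed ball of radius rho. Hence rho * normalize is firmly nonexpansive,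
    and normalize is a rho^-1-Lipschitz map on the whole space. Likewise, every
    nearest point of C is the value of the projection P onto the closure of C,
    which is defined everywhere because H is complete. Replacing the two
    projections in T by normalize and P gives a single-valued map F (dr_ext)
    that agrees with T off the ball wherever T has a value.

    F is rho^-1-Lipschitz on H (dr_ext_lipschitz). The reason is
      2 normalize - I = (2 rho normalize - I) + 2 (rho^-1 - 1) (rho normalize):
    the first summand is the reflection in a ball, hence 1-Lipschitz, and the
    second has Lipschitz constant 2 (rho^-1 - 1), so the sum has constant
    2 rho^-1 - 1; the reflection in the closure of C is 1-Lipschitz, and the
    average with I has constant (1 + (2 rho^-1 - 1)) / 2 = rho^-1.

    Now shrink F towards x0: G x = x0 + alpha rho (F x - x0). As
    alpha rho <= 1, G is alpha-Lipschitz on all of H, so its n-th iterate is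
    alpha^n-Lipschitz, and B[x0, r] has diameter at most 2 r. Moreover
    |G x - F x| = (1 - alpha rho) |F x - x0|, and |F x - x0| <= r + 2 <= 2 r
    (dr_ext_dist_le), because the reflection in C fixes x0, normalize takes
    values in the unit ball, and r >= 2 / rho >= 2. *)

(** * Calculus of the inner product *)

Section InnerProduct.
Context {R : realType} {H : normedModType R} (dot : {dot H for idfun}).
Context (dot_norm : forall x : H, dot x x = `|x| ^+ 2).
Implicit Types (a b x y z p q : H) (C : set H) (s : R).

Lemma dotC x y : dot x y = dot y x.
Proof. by rewrite hermC expr0 mul1r. Qed.

Lemma dotDl x y z : dot (x + y) z = dot x z + dot y z.
Proof. by rewrite linearDl. Qed.

Lemma dotNl x z : dot (- x) z = - dot x z.
Proof. by rewrite linearNl. Qed.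

Lemma dotZl s x z : dot (s *: x) z = s * dot x z.
Proof. by rewrite linearZl_LR. Qed.

Lemma dotDr x y z : dot z (x + y) = dot z x + dot z y.
Proof. by rewrite linearDr. Qed.

Lemma dotNr x z : dot z (- x) = - dot z x.
Proof. by rewrite linearNr. Qed.

Lemma dotZr s x z : dot z (s *: x) = s * dot z x.
Proof. by rewrite linearZr_LR. Qed.

Definition dot_expand := (dotDl, dotDr, dotNl, dotNr, dotZl, dotZr).

(** Reduces an identity between vectors to the ring identity obtained by pairing
    both sides with an arbitrary vector. *)
Lemma dot_ext x y : (forall z, dot x z = dot y z) -> x = y.
Proof.
move=> xy; apply/eqP; rewrite -subr_eq0 -normr_eq0 -sqrf_eq0 -dot_norm.
by rewrite dotDl dotNl xy subrr.
Qed.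

Lemma dot_polarization x y :
  dot x y = 2^-1 * (`|x| ^+ 2 + `|y| ^+ 2 - `|x - y| ^+ 2).
Proof. rewrite -!dot_norm !dot_expand (dotC y x); lra. Qed.

Lemma normBZ_sq a b s :
  `|a - s *: b| ^+ 2 = `|a| ^+ 2 - 2 * s * dot a b + s ^+ 2 * `|b| ^+ 2.
Proof. by rewrite -!dot_norm !dot_expand (dotC b a); ring. Qed.

(** The parallelogram law for x - a and x - b, with the midpoint written in the
    form that convexity delivers. *)
Lemma midpoint_sq x a b :
  `|x - (2^-1 *: a + (1 - 2^-1) *: b)| ^+ 2 =
  2^-1 * (`|x - a| ^+ 2 + `|x - b| ^+ 2) - 4^-1 * `|a - b| ^+ 2.
Proof.
rewrite -!dot_norm !dot_expand (dotC a x) (dotC b x) (dotC b a); lra.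
Qed.

Lemma normB_sq_continuous x : continuous (fun y : H => `|x - y| ^+ 2).
Proof.
move=> y; apply: (@continuous_comp _ _ _ 
  (fun y : H => `|x - y|) (fun t : R => t ^+ 2)).
  apply: (continuous_comp _ (@norm_continuous _ _ _)).
  exact: (continuousB (@cst_continuous _ _ _ _)).
exact: exprn_continuous.
Qed.

Lemma dot_continuous x : continuous (dot x : H -> R).
Proof.
have -> : (dot x : H -> R) =
    (fun y => 2^-1 * (`|x| ^+ 2 + `|0 - y| ^+ 2 - `|x - y| ^+ 2)).
  by apply/funext => y; rewrite sub0r normrN dot_polarization.
move=> y; apply: cvgM; first exact: cvg_cst.
apply: cvgB; last exact: normB_sq_continuous.
by apply: cvgD; [exact: cvg_cst|exact: normB_sq_continuous].
Qed.

Lemma closure_sub_closed C (B : set H) p :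
  closed B -> C `<=` B -> closure C p -> B p.
Proof. by move=> cB CB; rewrite closureE => /(_ B); apply; split. Qed.

(** * Projection onto a convex set *)

(** The variational inequality that characterizes the projection of x onto the
    closure of a convex set. Asking it only of the points of C makes it easy to
    establish; p itself lies in the closure because a set that is not closed may
    have no nearest point. *)
Definition nearest_point C x p : Prop :=
  closure C p /\ forall z, C z -> dot (x - p) (z - p) <= 0.

Lemma nearest_point_closure C x p z :
  nearest_point C x p -> closure C z -> dot (x - p) (z - p) <= 0.
Proof.
move=> [_ Cp] Cz.
have cB : closed [set z | dot (x - p) z <= dot (x - p) p].
  apply: (@preimage_closed _ _ (dot (x - p)) [set t | t <= _]).
    by move=> ? _; exact: dot_continuous.
  exact: closed_le.
suff /= : [set z | dot (x - p) z <= dot (x - p) p] z.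
  by rewrite dotDr dotNr subr_le0.
apply: (closure_sub_closed cB _ Cz) => y /Cp.
by rewrite dotDr dotNr subr_le0.
Qed.

Lemma nearest_point_id C p : C p -> nearest_point C p p.
Proof.
by move=> Cp; split=> [|z _]; [exact: subset_closure|rewrite subrr linear0l].
Qed.

(** Firm nonexpansiveness of projections: test the inequality at x with the point
    q, test the one at y with the point p, and add. *)
Lemma nearest_point_firm C x y p q :
  nearest_point C x p -> nearest_point C y q ->
  `|p - q| ^+ 2 <= dot (x - y) (p - q).
Proof.
move=> xp yq.
have := nearest_point_closure xp yq.1; have := nearest_point_closure yq xp.1.
rewrite -dot_norm !dot_expand (dotC q p); lra.
Qed.

(** The next two lemmas are the consequences of firm nonexpansiveness in the form
    used below, where a is a difference of two points and b the difference of
    their projections. *)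
Lemma firm_norm_le a b : `|b| ^+ 2 <= dot a b -> `|b| <= `|a|.
Proof.
move=> ab; rewrite -(@ler_pXn2r _ 2) ?nnegrE//.
have : 0 <= `|a - b| ^+ 2 by rewrite exprn_ge0.
by rewrite -!dot_norm !dot_expand (dotC b a) in ab *; lra.
Qed.

Lemma firm_reflection_le a b : `|b| ^+ 2 <= dot a b -> `|2 *: b - a| <= `|a|.
Proof.
move=> ab; rewrite -(@ler_pXn2r _ 2) ?nnegrE//.
by rewrite -!dot_norm !dot_expand (dotC b a) in ab *; lra.
Qed.

Lemma nearest_point_uniq C x p q :
  nearest_point C x p -> nearest_point C x q -> p = q.
Proof.
move=> xp xq; apply/eqP; rewrite -subr_eq0 -normr_le0.
by have := firm_norm_le (nearest_point_firm xp xq); rewrite subrr normr0.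
Qed.

Lemma nearest_point_reflection_le C x y p q :
  nearest_point C x p -> nearest_point C y q ->
  `|(2 *: p - x) - (2 *: q - y)| <= `|x - y|.
Proof.
move=> xp yq; have := firm_reflection_le (nearest_point_firm xp yq).
by rewrite scalerBr !opprD !opprK !addrA (addrAC (2 *: p)).
Qed.

Lemma convex_set_segment C : convex_set C -> forall x y s, C x -> C y ->
  0 <= s -> s <= 1 -> C (s *: x + (1 - s) *: y).
Proof.
move=> cC x y s Cx Cy s0 s1.
have s01 : Itv.spec (@Itv.num_sem R) (Itv.Real `[0%Z, 1%Z]) s.
  by rewrite /Itv.num_sem/= !num_real/= in_itv/= s0.
have := cC x y (Itv.mk s01).
by rewrite !inE => /(_ Cx Cy).
Qed.

(** If p minimizes the distance to x, then moving from p a fraction s of the way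
    to z cannot decrease it; the first order term in s gives the inequality. As p
    need not be in C, the minimality along the segment is first shown for segments
    that start in C and then extended by continuity. *)
Lemma closest_nearest_point C x p : convex_set C -> closure C p ->
  (forall z, C z -> `|x - p| ^+ 2 <= `|x - z| ^+ 2) -> nearest_point C x p.
Proof.
move=> cC Cp minp; split=> // z Cz.
have minseg s : 0 <= s -> s <= 1 ->
    `|x - p| ^+ 2 <= `|x - (s *: z + (1 - s) *: p)| ^+ 2.
  move=> s0 s1.
  set B := [set c | `|x - p| ^+ 2 <= `|x - (s *: z + (1 - s) *: c)| ^+ 2].
  apply: (@closure_sub_closed C B) => //; last first.
    by move=> c Cc; apply: minp; exact: convex_set_segment.
  apply: (@preimage_closed _ _ (fun c => `|x - (s *: z + (1 - s) *: c)| ^+ 2)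
    [set t | _ <= t]); last exact: closed_ge.
  move=> c _; apply: (@continuous_comp _ _ _ (fun c => s *: z + (1 - s) *: c)
    (fun y => `|x - y| ^+ 2)); last exact: normB_sq_continuous.
  by apply: cvgD; [exact: cvg_cst|apply: cvgZr; exact: cvg_id].
rewrite leNgt; apply/negP => d0.
set d := dot _ _ in d0.
set N := `|z - p| ^+ 2.
have N0 : 0 <= N by rewrite exprn_ge0.
have dN0 : 0 < d + N by rewrite ltr_wpDr.
(* This s makes s * N < 2 * d, so the decrease 2 s d beats the term s^2 N. *)
set s := d / (d + N).
have s0 : 0 < s by rewrite divr_gt0.
have s1 : s <= 1 by rewrite ler_pdivrMr // mul1r lerDl.
have sE : s * (d + N) = d by rewrite divfK// gt_eqF.
have := minseg s (ltW s0) s1.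
have -> : x - (s *: z + (1 - s) *: p) = (x - p) - s *: (z - p).
  by rewrite scalerBl scale1r addrCA -scalerBr opprD addrA.
rewrite normBZ_sq -/d -/N; nra.
Qed.

(** Minimizing sequences for the distance to a convex set are Cauchy: the midpoint
    of two almost minimizing points lies in C, so its distance to x is no smaller
    than the infimum, and the parallelogram law leaves little room for their
    distance to each other. *)
Lemma minimizing_cauchy_sequence C x : convex_set C -> C !=set0 ->
  exists u : nat -> H, [/\ forall n, C (u n),
    forall n z, C z -> `|x - u n| ^+ 2 < `|x - z| ^+ 2 + n.+1%:R^-1 &
    cauchy (u @ \oo)].
Proof.
move=> cC [z0 Cz0].
pose D := [set `|x - z| ^+ 2 | z in C].
have D_lb : has_lbound D by exists 0 => _ [z _ <-]; rewrite exprn_ge0.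
have D_inf : has_inf D by split=> //; exists (`|x - z0| ^+ 2), z0.
have /choice[u uP] (n : nat) :
    exists z, C z /\ `|x - z| ^+ 2 < inf D + n.+1%:R^-1.
  have n0 : 0 < n.+1%:R^-1 :> R by rewrite invr_gt0.
  by have [_ [z Cz <-] zlt] := inf_adherent n0 D_inf; exists z.
have infD z : C z -> inf D <= `|x - z| ^+ 2.
  by move=> Cz; apply: inf_lbound => //; exists z.
exists u; split=> [n|n z Cz|]; first exact: (uP n).1.
  by apply: lt_le_trans (uP n).2 _; rewrite lerD2r infD.
apply: cauchy_exP => e e0.
(* With both errors below e^2/4 the squared distance is below 2 * (e^2/4 + e^2/4). *)
have e4 : 0 < e ^+ 2 / 4 by rewrite divr_gt0 ?exprn_gt0.
have [N _ Ne] := near_infty_natSinv_lt (PosNum e4).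
exists (u N); exists N => // j Nj; rewrite /= -ball_normE /=.
rewrite -(@ltr_pXn2r _ 2) ?nnegrE// ?ltW//.
have /= je := Ne _ Nj; have /= ie := Ne N (leqnn N).
have [[Ci ui] [Cj uj]] := (uP N, uP j).
have mid : C (2^-1 *: u N + (1 - 2^-1) *: u j).
  by apply: convex_set_segment => //; lra.
have := infD _ mid; rewrite midpoint_sq; move: ie je ui uj.
move: N.+1%:R^-1 j.+1%:R^-1 (`|u N - u j|) => a b c; lra.
Qed.

(** The projection onto a ball, written as rho times the vector
    x / max(rho, |x|), which coincides with x / |x| outside the ball. *)
Lemma ball_nearest_point (rho : R) x : 0 < rho ->
  nearest_point [set z | `|z| <= rho] x
    (rho *: ((Num.max rho `|x|)^-1 *: x)).
Proof.
move=> rho0; rewrite scalerA.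
have [xrho|rhox] := leP `|x| rho.
  by rewrite divff ?gt_eqF// scale1r; exact: nearest_point_id.
have x0 : 0 < `|x| by exact: lt_trans rhox.
split=> [|z /= zrho].
  apply: subset_closure => /=.
  by rewrite normrZ normrM normfV normr_id divfK ?gt_eqF// gtr0_norm.
set m := `|x| in x0 rhox *.
(* Cauchy-Schwarz for x and z, from the nonnegativity of |m z - rho x|^2. *)
have xz : dot x z <= rho * m.
  rewrite -(ler_pM2l (mulr_gt0 rho0 x0)).
  have : 0 <= `|m *: z - rho *: x| ^+ 2 by rewrite exprn_ge0.
  have : `|z| ^+ 2 <= rho ^+ 2 by rewrite ler_pXn2r ?nnegrE// ltW.
  rewrite -!dot_norm !dot_expand (dotC z x) !dot_norm -/m => z2.
  have : m ^+ 2 * `|z| ^+ 2 <= m ^+ 2 * rho ^+ 2 by rewrite ler_wpM2l ?sqr_ge0.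
  nra.
rewrite !dot_expand dot_norm -/m.
have k1 : 0 <= 1 - rho / m by rewrite subr_ge0 ler_pdivrMr ?mul1r ?ltW.
have km : rho / m * m = rho by rewrite divfK// gt_eqF.
set k := rho / m in k1 km *.
have : (1 - k) * (dot x z) <= (1 - k) * (rho * m) by rewrite ler_wpM2l.
rewrite -km; nra.
Qed.

Lemma metric_proj_le C x p z : metric_proj C x p -> C z ->
  `|x - p| <= `|x - z|.
Proof.
move=> [_ ->] Cz; apply: inf_lbound; last by exists z.
by exists 0 => _ [? _ <-].
Qed.

(** Any minimizer p on the sphere is the radial one q: comparing the distances to
    x gives dot q p >= 1, which forces p = q for unit vectors. *)
Lemma sphere_projE x p : x != 0 -> metric_proj (unit_sphere H) x p ->
  p = `|x|^-1 *: x.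
Proof.
move=> x0 Sp; have p1 : `|p| = 1 := Sp.1; set q := _ *: _.
have q1 : `|q| = 1 by rewrite normrZ normfV normr_id mulVf ?normr_eq0.
have m0 : 0 < `|x| by rewrite normr_gt0.
have : `|x - p| <= `|x - q| by exact: metric_proj_le Sp q1.
have xE : x = `|x| *: q by rewrite scalerA divff ?gt_eqF// scale1r.
clearbody q; rewrite -(@ler_pXn2r _ 2) ?nnegrE//.
have xdot y : dot x y = `|x| * dot q y by rewrite {1}xE dotZl.
move=> le1; apply/eqP; rewrite -subr_eq0 -normr_le0.
rewrite -(@ler_pXn2r _ 2) ?nnegrE// expr0n/=.
move: le1; rewrite -!dot_norm !dot_expand (dotC p x) (dotC q x) (dotC p q).
rewrite !xdot !dot_norm p1 q1.
move: m0; set m := `|x|; nra.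
Qed.

End InnerProduct.

Lemma nearest_point_exists (R : realType) (H : completeNormedModType R)
    (dot : {dot H for idfun}) (dot_norm : forall x : H, dot x x = `|x| ^+ 2)
    (C : set H) (x : H) : convex_set C -> C !=set0 ->
  exists p, nearest_point dot C x p.
Proof.
move=> cC C0.
have [u [Cu umin /cauchy_cvgP cu]] :=
  minimizing_cauchy_sequence dot_norm x cC C0.
exists (lim (u @ \oo)); apply: closest_nearest_point => // [|z Cz].
  apply: (closed_cvg (closure C) _ _ _ cu); first exact: closed_closure.
  by near=> n; exact: subset_closure.
apply/ler_addgt0Pr => e e0.
apply: (closed_cvg [set y | `|x - y| ^+ 2 <= `|x - z| ^+ 2 + e] _ _ _ cu).
  apply: (@preimage_closed _ _ (fun y => `|x - y| ^+ 2) [set t | t <= _]).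
    by move=> y _; exact: normB_sq_continuous.
  exact: closed_le.
near=> n => /=; apply: le_trans (ltW (umin n z Cz)) _.
rewrite lerD2l ltW//; near: n; exact: near_infty_natSinv_lt (PosNum e0).
Unshelve. all: by end_near. Qed.

(** * A Lipschitz extension of the Douglas-Rachford operator *)

Section LipschitzExtension.
Context {R : realType} {H : normedModType R} (dot : {dot H for idfun}).
Context (dot_norm : forall x : H, dot x x = `|x| ^+ 2).
Context (C : set H) (P : H -> H).
Context (P_nearest : forall x, nearest_point dot C x (P x)).
Context (rho : R) (rho0 : 0 < rho).
Implicit Types x y t : H.

(** The maximum removes the singularity of x / |x| at the origin. *)
Definition normalize x : H := (Num.max rho `|x|)^-1 *: x.

Definition dr_ext x : H :=
  let y := 2 *: normalize x - x in 2^-1 *: (x + (2 *: P y - y)).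

Lemma normalize_norm_le1 x : `|normalize x| <= 1.
Proof.
have m0 : 0 < Num.max rho `|x| by rewrite lt_max rho0.
by rewrite normrZ gtr0_norm ?invr_gt0// ler_pdivrMl// mulr1 le_max lexx orbT.
Qed.

(** If C is not closed, the operator has no value where the second projection
    fails to exist; where it exists, it is also the projection onto the closure. *)
Lemma dr_extE x t : rho <= `|x| ->
  douglas_rachford (unit_sphere H) C x t -> convex_set C -> t = dr_ext x.
Proof.
move=> rhox [w [y [p Sp <-] [q Cq <-]] <-] cC.
have x0 : x != 0 by rewrite -normr_gt0 (lt_le_trans rho0).
rewrite /dr_ext /normalize max_r// -(sphere_projE dot_norm x0 Sp).
congr (_ *: (_ + (_ *: _ - _))).
apply: (nearest_point_uniq dot_norm _ (P_nearest _)).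
apply: closest_nearest_point => //; first exact: subset_closure Cq.1.
by move=> z Cz; rewrite ler_pXn2r ?nnegrE// (metric_proj_le Cq).
Qed.

(** The reflection in the sphere is split into the reflection in the ball of radius
    rho and a multiple of the projection onto that ball. Estimating normalize and
    the identity separately would only give the constant rho^-1 + 1. *)
Lemma dr_ext_lipschitz x y : rho <= 1 ->
  `|dr_ext x - dr_ext y| <= rho^-1 * `|x - y|.
Proof.
move=> rho1.
have px := ball_nearest_point dot_norm x rho0.
have py := ball_nearest_point dot_norm y rho0.
have reflQ := nearest_point_reflection_le dot_norm px py.
have leQ := firm_norm_le dot_norm (nearest_point_firm dot_norm px py).
rewrite -/(normalize x) -/(normalize y) in reflQ leQ.
set u := 2 *: normalize x - x; set v := 2 *: normalize y - y.
have leC : `|(2 *: P u - u) - (2 *: P v - v)| <= `|u - v|.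
  exact: (nearest_point_reflection_le dot_norm (P_nearest u) (P_nearest v)).
set a := rho *: normalize x in reflQ leQ.
set b := rho *: normalize y in reflQ leQ.
have Qa z : normalize z = rho^-1 *: (rho *: normalize z).
  by rewrite scalerA mulVf ?gt_eqF// scale1r.
have uvE : u - v = ((2 *: a - x) - (2 *: b - y)) +
    (2 * (rho^-1 - 1)) *: (a - b).
  rewrite /u /v (Qa x) (Qa y) -/a -/b.
  apply: (dot_ext dot_norm) => z; rewrite !dot_expand; ring.
have rho1' : 0 <= rho^-1 - 1 by rewrite subr_ge0 invf_ge1.
have leuv : `|u - v| <= (2 * rho^-1 - 1) * `|x - y|.
  rewrite uvE; apply: le_trans (ler_normD _ _) _.
  rewrite normrZ ger0_norm ?mulr_ge0//.
  have := ler_wpM2l rho1' leQ; lra.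
rewrite /dr_ext -/u -/v -scalerBr normrZ ger0_norm ?invr_ge0//.
have := ler_normD (x - y) ((2 *: P u - u) - (2 *: P v - v)).
rewrite [x - y + _]addrACA -opprD; lra.
Qed.

(** The point x0 is fixed by the reflection in C, so the two reflections can be
    estimated by the distances to x0 alone. This bound has coefficient 1 at
    |x - x0|, whereas the Lipschitz bound has rho^-1. *)
Lemma dr_ext_dist_le x x0 : C x0 -> `|x0| = 1 ->
  `|dr_ext x - x0| <= `|x - x0| + 2.
Proof.
move=> Cx0 x01; rewrite /dr_ext; set u := _ - x.
have leC : `|(2 *: P u - u) - (2 *: x0 - x0)| <= `|u - x0|.
  exact: (nearest_point_reflection_le dot_norm (P_nearest u)
    (nearest_point_id dot Cx0)).
have leu : `|u - x0| <= 4 + `|x - x0|.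
  have -> : u - x0 = 2 *: (normalize x - x0) - (x - x0).
    apply: (dot_ext dot_norm) => z; rewrite !dot_expand; ring.
  apply: le_trans (ler_normB _ _) _; rewrite lerD2r normrZ ger0_norm//.
  have := ler_normB (normalize x) x0; have := normalize_norm_le1 x.
  rewrite x01; lra.
have -> : 2^-1 *: (x + (2 *: P u - u)) - x0 =
    2^-1 *: ((x - x0) + ((2 *: P u - u) - (2 *: x0 - x0))).
  apply: (dot_ext dot_norm) => z; rewrite !dot_expand; lra.
rewrite normrZ ger0_norm ?invr_ge0//.
have := ler_normD (x - x0) ((2 *: P u - u) - (2 *: x0 - x0)).
lra.
Qed.

End LipschitzExtension.

Lemma iter_lipschitz (R : realType) (V : normedModType R) (G : V -> V) (k : R) :
  0 <= k -> (forall x y, `|G x - G y| <= k * `|x - y|) ->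
  forall n x y, `|iter n G x - iter n G y| <= k ^+ n * `|x - y|.
Proof.
move=> k0 Gk; elim=> [|n IH] x y; first by rewrite expr0 mul1r.
by apply: le_trans (Gk _ _) _; rewrite exprS -mulrA; apply: ler_wpM2l (IH x y).
Qed.

(** * Shrinking the extension towards a point of the sphere and C *)

Theorem theorem1p1 (R : realType) (H : completeNormedModType R)
    (dot : {dot H for idfun}) (dot_norm : forall x : H, dot x x = `|x| ^+ 2)
    (C : set H) (convexC : convex_set C)
    (SC_neq0 : unit_sphere H `&` C !=set0)
    (x0 : H) (x0SC : (unit_sphere H `&` C) x0)
    (alpha beta r : R)
    (alpha_ge0 : 0 <= alpha) (beta_ge0 : 0 <= beta) (r_ge0 : 0 <= r)
    (beta_lt1 : beta < 1)
    (r_ge : 2 / (1 - beta) <= r) (alpha_le : alpha <= 1 / (1 - beta)) :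
  exists G : H -> H,
    (ereal_sup [set e : \bar R | exists x t : H,
        [/\ (closed_ball x0 r `\` ball (0 : H) (1 - beta)) x,
            douglas_rachford (unit_sphere H) C x t &
            e = (`|G x - t|)%:E]]%R
      <= (2 * r * (1 - alpha * (1 - beta)))%R%:E)%E /\
    (forall n : nat,
      (ereal_sup [set e : \bar R | exists x y : H,
        [/\ closed_ball x0 r x, closed_ball x0 r y &
            e = (`|iter n G x - iter n G y|)%:E]]%R
      <= (2 * r * alpha ^+ n)%R%:E)%E).
Proof.
have [x0S Cx0] := x0SC.
set rho := 1 - beta in r_ge alpha_le *.
have rho0 : 0 < rho by rewrite /rho; lra.
have rho1 : rho <= 1 by rewrite /rho; lra.
have k0 : 0 <= alpha * rho by rewrite mulr_ge0// ltW.
have k1 : alpha * rho <= 1 by rewrite -ler_pdivlMr.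
have r2 : 2 <= r by apply: le_trans r_ge; rewrite ler_pdivlMr//; lra.
have C0 : C !=set0 by exists x0.
have /choice[P P_nearest] (x : H) : exists p, nearest_point dot C x p.
  exact: nearest_point_exists.
pose F := dr_ext P rho.
pose G x := x0 + (alpha * rho) *: (F x - x0).
have closed_ballP x : closed_ball x0 r x -> `|x - x0| <= r.
  by rewrite closed_ballE ?(lt_le_trans _ r2)// /closed_ball_ /= distrC.
have G_lip x y : `|G x - G y| <= alpha * `|x - y|.
  have -> : G x - G y = (alpha * rho) *: (F x - F y).
    by rewrite /G opprD addrACA subrr add0r -scalerBr opprB addrA subrK.
  rewrite normrZ ger0_norm// -mulrA ler_wpM2l//.
  rewrite -ler_pdivlMl//.
  exact: (dr_ext_lipschitz dot_norm P_nearest).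
exists G; split=> [|n]; apply: ge_ereal_sup => e /=.
  move=> [x [t [[/= xB xrho] Tt ->]]]; rewrite lee_fin.
  have xr := closed_ballP x xB.
  have rhox : rho <= `|x|.
    rewrite leNgt; apply/negP => xlt; apply: xrho.
    by rewrite -ball_normE /= sub0r normrN.
  rewrite (dr_extE dot_norm P_nearest rho0 rhox Tt convexC) -/(F x).
  have -> : G x - F x = (alpha * rho - 1) *: (F x - x0).
    apply: (dot_ext dot_norm) => z; rewrite !dot_expand; ring.
  rewrite normrZ ler0_norm ?subr_le0// opprB mulrC ler_wpM2r ?subr_ge0//.
  have := dr_ext_dist_le dot_norm P_nearest rho0 x Cx0 x0S.
  rewrite -/F; lra.
move=> [x [y [xB yB ->]]]; rewrite lee_fin.
have xr := closed_ballP x xB; have yr := closed_ballP y yB.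
apply: le_trans (iter_lipschitz alpha_ge0 G_lip n x y) _.
rewrite mulrC ler_wpM2r ?exprn_ge0//.
have := ler_normB (x - x0) (y - x0); rewrite opprB addrA subrK; lra.
Qed.
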